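(* Let $\mathscr{H}$ be a Hilbert space, and let $\{\varphi_n\}_{n\in\mathbb{N}}$ be a frame in $\mathscr{H}$ with frame bounds $a,b$, where $0<a\le b<\infty$. Suppose further that there is a set $\Omega$ such that each $\varphi_n$ is a function on $\Omega$, and that $$\left(\varphi_n(t)\right)_{n\in\mathbb{N}}\in l^2\quad\text{for all } t\in\Omega.$$ Then $\mathscr{H}$ is a reproducing kernel Hilbert space of functions on $\Omega$.
   Context: Inner products are linear in the second variable, and $l^2=l^2(\mathbb{N})$. A system $\{\varphi_n\}_{n\in\mathbb{N}}\subset\mathscr{H}$ is a frame with frame bounds $a,b$ ($0<a\le b<\infty$) if $a\|f\|_{\mathscr{H}}^2\le\sum_{n=1}^{\infty}|\langle\varphi_n,f\rangle_{\mathscr{H}}|^2\le b\|f\|_{\mathscr{H}}^2$ for all $f\in\mathscr{H}$. A Hilbert space $\mathscr{H}$ of (complex-valued) functions on a set $\Omega$ is a reproducing kernel Hilbert space (RKHS) if for all $t\in\Omega$ the map $\mathscr{H}\ni f\mapsto f(t)\in\mathbb{C}$ is norm-continuous; equivalently, if for all $t\in\Omega$ there exists $K_t\in\mathscr{H}$ such that $f(t)=\langle K_t,f\rangle_{\mathscr{H}}$ for all $f\in\mathscr{H}$.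
   Formalization: ''Each φ_n is a function on Ω'' is made precise by an added assumption, without which the claim fails: for c in l², Σ c_n φ_n = 0 in H iff Σ c_n φ_n(t) = 0 for all t in Ω. The conclusion gives a realization of H as an RKHS on Ω in which the vectors φ_n are the given functions. *)

(* Defs.v *)
From HB Require Import structures.
From mathcomp Require Import all_boot all_order all_algebra.
From mathcomp Require Import complex.
From mathcomp Require Import all_classical all_reals all_analysis.

Set Implicit Arguments.
Unset Strict Implicit.
Unset Printing Implicit Defensive.

Import Order.TTheory GRing.Theory Num.Theory.
Import numFieldNormedType.Exports.

Local Open Scope classical_set_scope.
Local Open Scope ring_scope.

(* [R[i]^o] is [R[i]] with its structure of normed module over itself, which
   carries the usual topology of the complex plane. *)
Notation Cplx R := (R[i]^o)%type.

(* The modulus of a complex number, as a real number. *)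
Definition modulus (R : realType) (z : R[i]) : R := complex.Re `|z|.

(* The norm of a normed module over [R[i]] takes its values in [R[i]]; this is
   the same norm as a real number. *)
Definition hnorm (R : realType) (H : normedModType R[i]) (f : H) : R :=
  complex.Re `|f|.

(* A Hilbert space is a complete normed module over [R[i]] whose norm comes
   from an inner product. *)
Definition hilbert_norm (R : realType) (H : normedModType R[i])
    (dotp : {dot H for (@Num.conj R[i])}) : Prop :=
  forall f : H, `|f| ^+ 2 = dotp f f.

(* The forms of the library are linear in their first argument; the inner
   product here is linear in the second one. *)
Definition inner (R : realType) (H : normedModType R[i])
    (dotp : {dot H for (@Num.conj R[i])}) (f g : H) : R[i] := dotp g f.

Definition frame (R : realType) (H : normedModType R[i])
    (dotp : {dot H for (@Num.conj R[i])}) (phi : nat -> H) (a b : R) : Prop :=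
  [/\ 0 < a, a <= b &
    forall f : H,
      ((a * hnorm f ^+ 2)%:E
         <= \sum_(n <oo) (modulus (inner dotp (phi n) f) ^+ 2)%:E
         <= (b * hnorm f ^+ 2)%:E)%E].

Definition in_l2 (R : realType) (c : nat -> R[i]) : Prop :=
  (\sum_(n <oo) (modulus (c n) ^+ 2)%:E < +oo)%E.

(* The meaning of "the vector [phi n] is the function [g n]": an l^2-combination
   of the vectors is zero in [H] exactly when the same combination of the
   functions is zero at every point.  The forward direction says that the vector
   [\sum_n c n *: phi n] determines the function [\sum_n c n *: g n], the backward
   one that the function determines the vector.  Both are necessary for [H] to
   be a space of functions with continuous evaluations in which [phi n] is
   [g n], and neither follows from the l^2 condition. *)
Definition vectors_are_functions (R : realType) (H : normedModType R[i])
    (Omega : Type) (phi : nat -> H) (g : nat -> Omega -> Cplx R) : Prop :=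
  forall c : nat -> R[i], in_l2 c ->
    (series (fun n => c n *: phi n) @ \oo --> (0 : H)) <->
    (forall t : Omega, series (fun n => c n *: g n t) @ \oo --> (0 : Cplx R)).

(* The space [H] consists of functions on [Omega], with pointwise operations:
   [ev f t] is the value at [t] of the element [f] of [H]. *)
Definition space_of_functions (R : realType) (H : normedModType R[i])
    (Omega : Type) (ev : H -> (Omega -> Cplx R)) : Prop :=
  linear ev /\ injective ev.

Definition rkhs (R : realType) (H : normedModType R[i])
    (Omega : Type) (ev : H -> (Omega -> Cplx R)) : Prop :=
  space_of_functions ev /\
  forall t : Omega, continuous (fun f : H => ev f t).

(* Main.v *)
(* The synthesis map T c = \sum_n c_n phi_n is bounded on l^2, and it is onto:
   S f = \sum_n <phi_n, f> phi_n satisfies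
   ||f - S f / b||^2 <= (1 - a / b) ||f||^2, so S / b is invertible by a Neumann
   series, and every f is T c for some c with ||c||^2 <= K ||f||^2.  By
   hypothesis T and the pointwise synthesis c |-> (t |-> \sum_n c_n g_n(t)) have
   the same kernel, so the value of f at t is well defined as
   \sum_n c_n g_n(t), and f |-> (t |-> f(t)) is injective.  As c and (g_n(t))_n
   are in l^2, with ||c|| controlled by ||f||, the value is continuous in f. *)
Require Import Defs.
From HB Require Import structures.
From mathcomp Require Import all_boot all_order all_algebra.
From mathcomp Require Import complex.
From mathcomp Require Import all_classical all_reals all_analysis.
From mathcomp Require Import ring lra.

Set Implicit Arguments.
Unset Strict Implicit.
Unset Printing Implicit Defensive.

Import Order.TTheory GRing.Theory Num.Theory.
Import numFieldNormedType.Exports.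

Local Open Scope classical_set_scope.
Local Open Scope ring_scope.
Local Open Scope complex_scope.

(** * Real-valued norms and convergence in normed modules over [R[i]] *)

Section HNorm.
Variables (R : realType).
Implicit Type V : normedModType R[i].

Lemma hnormE V (f : V) : (hnorm f)%:C = `|f|.
Proof. by rewrite /hnorm RRe_real// ger0_real. Qed.

Lemma hnorm_ge0 V (f : V) : 0 <= hnorm f.
Proof. by rewrite -ler0c hnormE. Qed.

Lemma hnorm0 V : hnorm (0 : V) = 0.
Proof. by rewrite /hnorm normr0. Qed.

Lemma hnorm_opp V (f : V) : hnorm (- f) = hnorm f.
Proof. by rewrite /hnorm normrN. Qed.

Lemma ler_hnormD V (f h : V) : hnorm (f + h) <= hnorm f + hnorm h.
Proof. by rewrite -lecR rmorphD/= !hnormE ler_normD. Qed.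

Lemma ler_hnormB V (f h : V) : hnorm (f - h) <= hnorm f + hnorm h.
Proof. by rewrite -(hnorm_opp h) ler_hnormD. Qed.

Lemma modulus_hnorm (z : R[i]) : modulus z = hnorm (z : Cplx R).
Proof. by []. Qed.

Lemma modulus_ge0 (z : R[i]) : 0 <= modulus z.
Proof. exact: (@hnorm_ge0 (Cplx R)). Qed.

Lemma sq_modulus_ge0 (z : R[i]) : 0 <= modulus z ^+ 2.
Proof. exact/exprn_ge0/modulus_ge0. Qed.

Lemma modulusE (z : R[i]) : (modulus z)%:C = `|z|.
Proof. exact: (@hnormE (Cplx R)). Qed.

Lemma modulusM (y z : R[i]) : modulus (y * z) = modulus y * modulus z.
Proof. by apply: complexI; rewrite rmorphM/= !modulusE normrM. Qed.

Lemma hnormZ V (z : R[i]) (f : V) : hnorm (z *: f) = modulus z * hnorm f.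
Proof. by apply: complexI; rewrite rmorphM/= modulusE !hnormE normrZ. Qed.

Lemma ler_hnorm_sum V (I : Type) (r : seq I) (v : I -> V) :
  hnorm (\sum_(i <- r) v i) <= \sum_(i <- r) hnorm (v i).
Proof.
elim/big_ind2: _ => [|f x h y fx hy|//]; first by rewrite hnorm0.
by rewrite (le_trans (ler_hnormD _ _)) ?lerD.
Qed.

Lemma cvg_hnormP V (T : Type) (F : set_system T) {FF : Filter F}
    (u : T -> V) (l : V) :
  u @ F --> l <-> forall e : R, 0 < e -> \forall x \near F, hnorm (l - u x) < e.
Proof.
rewrite cvgrPdist_lt; split=> ul e e0.
  have e0' : 0 < e%:C by rewrite ltcR.
  by apply: filterS (ul _ e0') => x; rewrite -hnormE ltcR.
(* A positive element of [R[i]] is real, so [e] loses nothing when replaced by its real part. *)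
have eE : (complex.Re e)%:C = e by rewrite RRe_real// gtr0_real.
have e0' : 0 < complex.Re e by rewrite -ltcR eE.
by apply: filterS (ul _ e0') => x; rewrite -hnormE -eE ltcR.
Qed.

Lemma cvg_hnorm V (u : nat -> V) (l : V) :
  u @ \oo --> l -> hnorm (u n) @[n --> \oo] --> hnorm l.
Proof.
move=> /cvg_hnormP ul; apply/cvgrPdist_lt => e e0.
apply: filterS (ul _ e0) => n; apply: le_lt_trans.
rewrite ler_norml; apply/andP; split.
  have := ler_hnormB l (l - u n); rewrite subKr; lra.
by have := ler_hnormD (l - u n) (u n); rewrite subrK; lra.
Qed.

Lemma hnorm_sq_cvg_le V (u : nat -> V) (l : V) (x : nat -> R) (y : R) :
  u @ \oo --> l -> x @ \oo --> y -> (forall n, hnorm (u n) ^+ 2 <= x n) ->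
  hnorm l ^+ 2 <= y.
Proof.
move=> ul xy ux.
have ul2 : hnorm (u n) ^+ 2 @[n --> \oo] --> hnorm l ^+ 2.
  rewrite expr2 (_ : (fun n => _) = (fun n => hnorm (u n) * hnorm (u n)))//.
  by apply: cvgM; exact: cvg_hnorm.
by apply: ler_cvg_to ul2 xy _; near=> n; exact: ux.
Unshelve. all: by end_near. Qed.

(** Cauchy criterion by comparison of blocks. The exponent is 1 for the Neumann series and 2 for the
    synthesis map, whose blocks are controlled only through squared norms. *)
Lemma cvg_series_hnorm (H : completeNormedModType R[i]) (p : nat)
    (v : nat -> H) (w : nat -> R) : (0 < p)%N ->
  (forall m n, hnorm (\sum_(m <= k < n) v k) ^+ p <= \sum_(m <= k < n) w k) ->
  cvgn (series w) -> cvgn (series v).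
Proof.
move=> p0 vw /cauchy_cvgP/cauchy_seriesP cw.
apply/cauchy_cvgP/cauchy_seriesP => e e0.
have eE : (complex.Re e)%:C = e by rewrite RRe_real// gtr0_real.
have e0' : 0 < complex.Re e by rewrite -ltcR eE.
apply: filterS (cw _ (exprn_gt0 p e0')) => n /= wn.
rewrite -hnormE -eE ltcR -(ltr_pXn2r p0) ?nnegrE ?hnorm_ge0 1?ltW//.
exact: le_lt_trans (vw _ _) (le_lt_trans (ler_norm _) wn).
Qed.

(** * Complex series through their real and imaginary parts *)

Lemma ler_modulus_ReIm (z : R[i]) :
  modulus z <= `|complex.Re z| + `|complex.Im z|.
Proof.
rewrite -lecR modulusE {1}[z]complexE rmorphD/=.
apply: le_trans (ler_normD _ _) _; rewrite normrM lerD//.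
  by rewrite normc_def/= expr0n/= addr0 sqrtr_sqr.
by rewrite complexiE normCi mul1r normc_def/= expr0n/= addr0 sqrtr_sqr.
Qed.

Lemma ler_modulus_Re (z : R[i]) : `|complex.Re z| <= modulus z.
Proof. by rewrite -lecR modulusE; exact: normc_ge_Re. Qed.

Lemma ler_modulus_Im (z : R[i]) : `|complex.Im z| <= modulus z.
Proof.
(* Up to sign, the imaginary part is the real part after multiplication by i, which preserves the
   modulus. *)
rewrite -normrN -ReiNIm; apply: le_trans (ler_modulus_Re _) _.
by rewrite -lecR !modulusE complexiE normrM normCi mulr1.
Qed.

Lemma series_ReIm (z : nat -> Cplx R) n :
  series z n =
    Complex (series (@complex.Re R \o z) n) (series (@complex.Im R \o z) n).
Proof.
elim: n => [|n IHn]; first by rewrite /series/= !big_geq.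
by rewrite !seriesSr IHn/=; case: (z n).
Qed.

Lemma cplx_abs_cvg_series (z : nat -> Cplx R) :
  cvgn (series (fun n => modulus (z n))) -> cvgn (series z).
Proof.
move=> cz.
have part (h : R[i] -> R) :
    (forall y, `|h y| <= modulus y) -> cvgn (series (h \o z)).
  move=> hle; apply: normed_cvg; apply: series_le_cvg cz => n /=.
  - exact: normr_ge0.
  - exact: modulus_ge0.
  - exact: hle.
have /cvg_ex[/= x xP] := part _ ler_modulus_Re.
have /cvg_ex[/= y yP] := part _ ler_modulus_Im.
apply/cvg_ex; exists (x +i* y); apply/cvg_hnormP => e e0.
have e20 : 0 < e / 2 by lra.
have /cvgrPdist_lt/(_ _ e20) xn := xP.
have /cvgrPdist_lt/(_ _ e20) yn := yP.
apply: filterS2 xn yn => n xn yn.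
rewrite -modulus_hnorm series_ReIm.
apply: le_lt_trans (ler_modulus_ReIm _) _ => /=.
by move: xn yn; lra.
Qed.

(** Kept general in [V] because it serves both the series of vectors [phi n] in [H] and the series
    of values [g n t]. *)
Lemma cvg_series_lincomb V (v : nat -> V) (c d : nat -> R[i])
    (k : R[i]) (x y : V) :
  series (fun n => c n *: v n) @ \oo --> x ->
  series (fun n => d n *: v n) @ \oo --> y ->
  series (fun n => (k * c n + d n) *: v n) @ \oo --> k *: x + y.
Proof.
move=> cx dy.
rewrite (_ : series _ = (fun n => k *: series (fun n => c n *: v n) n
                                    + series (fun n => d n *: v n) n)).
  by apply: cvgD => //; exact: cvgZl_tmp.
apply/funext => n; rewrite /series/= scaler_sumr -big_split/=.
by apply: eq_bigr => i _; rewrite scalerDl scalerA.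
Qed.

Lemma cvg_series_diff V (v : nat -> V) (c d : nat -> R[i]) (x y : V) :
  series (fun n => c n *: v n) @ \oo --> x ->
  series (fun n => d n *: v n) @ \oo --> y ->
  series (fun n => (-1 * c n + d n) *: v n) @ \oo --> y - x.
Proof.
by move=> cx dy; rewrite [y - x]addrC -[- x]scaleN1r; exact: cvg_series_lincomb.
Qed.

Lemma cvg_series_single (K : numFieldType) (W : normedModType K) (x : W) m :
  series (fun n => if n == m then x else 0) @ \oo --> x.
Proof.
(* The partial sum at [n] runs over indices below [n], so it contains the term [m] from [n = m.+1]
   on. *)
apply: cvg_near_cst; exists m.+1 => // n /= mn.
rewrite /series/= (big_cat_nat (leq0n m.+1) mn)/= big_nat_recr//= eqxx.
rewrite [X in X + _ + _]big1_seq ?[X in _ + X]big1_seq ?add0r ?addr0//.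
- by move=> i /=; rewrite mem_index_iota => /andP[mi _]; rewrite gtn_eqF.
- by move=> i /=; rewrite mem_index_iota => /andP[_ im]; rewrite ltn_eqF.
Qed.

Lemma cvg_series_EFin (w : nat -> R) : (forall n, 0 <= w n) ->
  (\sum_(n <oo) (w n)%:E < +oo)%E -> cvgn (series w).
Proof.
move=> w0 wfin; apply: nondecreasing_is_cvgn.
  by apply: nondecreasing_series => n _ _; exact: w0.
exists (fine (\sum_(n <oo) (w n)%:E)) => _ [n _ <-].
rewrite -lee_fin fineK.
  rewrite /series/= -sumEFin; apply: nneseries_lim_ge => k _ _.
  by rewrite lee_fin.
rewrite ge0_fin_numE//; apply: nneseries_ge0 => k _ _.
by rewrite lee_fin.
Qed.

Lemma nneseries_EFin (w : nat -> R) : cvgn (series w) ->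
  (\sum_(n <oo) (w n)%:E)%E = (limn (series w))%:E.
Proof.
move=> cw; rewrite -EFin_lim//; apply/congr_lim/funext => n /=.
by rewrite sumEFin.
Qed.

Lemma ler_series_lim (w : nat -> R) n : (forall n, 0 <= w n) ->
  cvgn (series w) -> series w n <= limn (series w).
Proof.
move=> w0 cw; apply: nondecreasing_cvgn_le cw n.
by apply: nondecreasing_series => k _ _; exact: w0.
Qed.

(** Neumann series: the sum [u] of the iterates of [E] at [f] is dominated by a geometric series,
    and applying [E] to it only drops the first term [f]. *)
Lemma contraction_resolvent (H : completeNormedModType R[i])
    (E : {linear H -> H}) (q : R) : 0 <= q -> q < 1 ->
  (forall f, hnorm (E f) <= q * hnorm f) ->
  forall f, exists u, u - E u = f.
Proof.
move=> q0 q1 Eq f.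
pose v n := iter n E f.
have vq n : hnorm (v n) <= geometric (hnorm f) q n.
  elim: n => [|n IHn] /=; first by rewrite expr0 mulr1.
  apply: le_trans (Eq _) _.
  by rewrite exprS mulrCA ler_wpM2l.
have /cvg_ex[/= u uP] : cvgn (series v).
  apply: (@cvg_series_hnorm _ 1 _ (geometric (hnorm f) q)) => // [m n|].
    by rewrite expr1 (le_trans (ler_hnorm_sum _ _))// ler_sum.
  by apply: is_cvg_geometric_series; rewrite ger0_norm.
have Ev n : E (series v n) = series v n.+1 - f.
  by rewrite /series/= big_nat_recl// -/(v 0) addrC addKr linear_sum.
exists u.
(* The contraction bound makes [E] continuous; the limit found here is compared with the one given
   by the index shift [Ev]. *)
have Eu : E (series v n) @[n --> \oo] --> E u.
  apply/cvg_hnormP => e e0.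
  have /cvg_hnormP/(_ _ e0) := uP; apply: filterS => n; apply: le_lt_trans.
  by rewrite -linearB (le_trans (Eq _))// ler_piMl ?hnorm_ge0// ltW.
have Eu' : E (series v n) @[n --> \oo] --> u - f.
  rewrite (_ : (fun n => _) = (fun n => series v n.+1 - f)); last exact/funext.
  apply: cvgB; last exact: cvg_cst.
  by rewrite -(cvg_shiftS (series v)) in uP.
by rewrite (cvg_unique _ Eu Eu')// subKr.
Qed.

End HNorm.

Arguments cvg_series_lincomb {R V v c d} k {x y}.

(** * The frame operator and expansions with controlled coefficients *)

Section Frame.
Variables (R : realType) (H : completeNormedModType R[i]).
Variables (dotp : {dot H for (@Num.conj R[i])}) (hilbertH : hilbert_norm dotp).
Variables (phi : nat -> H) (a b : R) (phi_frame : frame dotp phi a b).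

Let coef (f : H) n := inner dotp (phi n) f.

Lemma frame_ub_gt0 : 0 < b.
Proof. by have [a0 ab _] := phi_frame; exact: lt_le_trans ab. Qed.

Lemma dotp_hnorm f : dotp f f = (hnorm f ^+ 2)%:C.
Proof. by rewrite -hilbertH rmorphXn/= hnormE. Qed.

Lemma modulus_inner f h : modulus (inner dotp f h) = modulus (inner dotp h f).
Proof.
by apply: complexI; rewrite !modulusE/inner hermC expr0 mul1r norm_conjC.
Qed.

Lemma frame_coef f :
  [/\ cvgn (series (fun n => modulus (coef f n) ^+ 2)),
     a * hnorm f ^+ 2 <= limn (series (fun n => modulus (coef f n) ^+ 2)) &
     limn (series (fun n => modulus (coef f n) ^+ 2)) <= b * hnorm f ^+ 2].
Proof.
have [_ _ /(_ f)/andP[lo hi]] := phi_frame.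
have cf : cvgn (series (fun n => modulus (coef f n) ^+ 2)).
  apply: cvg_series_EFin => [n|]; first exact: sq_modulus_ge0.
  by apply: le_lt_trans hi _; rewrite ltry.
by move: lo hi; rewrite nneseries_EFin// !lee_fin.
Qed.

(* For x = \sum c_k phi_k, ||x||^2 = \sum c_k <x, phi_k>; weighted AM-GM against
   the upper frame bound of x itself leaves half of ||x||^2 to absorb. *)
Lemma synthesis_bound (c : nat -> R[i]) m n :
  hnorm (\sum_(m <= k < n) c k *: phi k) ^+ 2
    <= b * \sum_(m <= k < n) modulus (c k) ^+ 2.
Proof.
have b0 := frame_ub_gt0.
set x := \sum_(_ <= _ < _) _.
have [cx _ xb] := frame_coef x.
have bessel : \sum_(m <= k < n) modulus (coef x k) ^+ 2 <= b * hnorm x ^+ 2.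
  apply: le_trans xb.
  apply: le_trans (ler_series_lim n (fun k => sq_modulus_ge0 _) cx).
  have [mn|nm] := leqP m n; last first.
    by rewrite big_geq 1?ltnW//; apply: sumr_ge0 => k _; exact: sq_modulus_ge0.
  rewrite /series/= (big_cat_nat (leq0n m) mn)/= lerDr.
  by apply: sumr_ge0 => k _; exact: sq_modulus_ge0.
have xx : hnorm x ^+ 2 <= \sum_(m <= k < n) modulus (c k) * modulus (coef x k).
  have x0 : 0 <= dotp x x by rewrite dotp_hnorm ler0c sqr_ge0.
  rewrite -lecR -dotp_hnorm -(ger0_norm x0) {1}/x linear_sumlz rmorph_sum/=.
  apply: le_trans (ler_norm_sum _ _ _) _; apply: ler_sum => k _.
  rewrite linearZl_LR normrM rmorphM/= [modulus (coef _ _)]modulus_inner.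
  by rewrite !modulusE.
suff : \sum_(m <= k < n) modulus (c k) * modulus (coef x k) <=
    (b * \sum_(m <= k < n) modulus (c k) ^+ 2
     + b^-1 * \sum_(m <= k < n) modulus (coef x k) ^+ 2) / 2.
  have : b^-1 * \sum_(m <= k < n) modulus (coef x k) ^+ 2 <= hnorm x ^+ 2.
    by rewrite ler_pdivrMl.
  lra.
rewrite !mulr_sumr -big_split/= mulr_suml; apply: ler_sum => k _.
set s := modulus _; set t := modulus _.
rewrite -subr_ge0.
have -> : (b * s ^+ 2 + b^-1 * t ^+ 2) / 2 - s * t =
    b * (s - b^-1 * t) ^+ 2 / 2.
  by field; rewrite gt_eqF.
by rewrite divr_ge0// mulr_ge0 ?sqr_ge0// ltW.
Qed.

Lemma synthesis_cvg (c : nat -> R[i]) :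
  cvgn (series (fun n => modulus (c n) ^+ 2)) ->
  cvgn (series (fun n => c n *: phi n)).
Proof.
move=> cc; pose w n := modulus (c n) ^+ 2.
apply: (@cvg_series_hnorm _ _ 2 _ (b *: w)) => //.
  by move=> m n; rewrite (le_trans (synthesis_bound _ _ _))// mulr_sumr.
exact: is_cvg_seriesZ.
Qed.

(** The frame operator S, that is, synthesis applied to the frame coefficients. *)
Let frame_op f : H := limn (series (fun n => coef f n *: phi n)).

(** The operator I - S / b; the scaling by the upper frame bound is what makes it a contraction. *)
Let err f : H := f - (b^-1)%:C *: frame_op f.

Lemma frame_op_cvg f : series (fun n => coef f n *: phi n) @ \oo --> frame_op f.
Proof. by apply: synthesis_cvg; have [] := frame_coef f. Qed.

Lemma err_linear : linear err.
Proof.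
move=> k f h; rewrite /err.
have -> : frame_op (k *: f + h) = k *: frame_op f + frame_op h.
  apply: cvg_lim; first exact: norm_hausdorff.
  rewrite (_ : (fun n => _) = fun n => (k * coef f n + coef h n) *: phi n).
    by apply: cvg_series_lincomb; exact: frame_op_cvg.
  by apply/funext => n; rewrite /coef/inner linearDl linearZl_LR.
by rewrite scalerDr scalerA mulrC -scalerA scalerBr addrACA opprD.
Qed.

(* ||f - S f / b||^2 = ||f||^2 - 2 <f, S f> / b + ||S f||^2 / b^2, where
   ||S f||^2 <= b <f, S f> and <f, S f> >= a ||f||^2; done on partial sums. *)
Lemma err_bound f : hnorm (err f) ^+ 2 <= (1 - a / b) * hnorm f ^+ 2.
Proof.
have b0 := frame_ub_gt0.
pose s := series (fun n => modulus (coef f n) ^+ 2).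
have [sc lo _] := frame_coef f.
apply: (@le_trans _ _ (hnorm f ^+ 2 - b^-1 * limn s)); last first.
  by rewrite mulrBl mul1r lerD2l lerN2 mulrAC mulrC ler_wpM2l// invr_ge0 ltW.
pose S := series (fun n => coef f n *: phi n).
apply: (@hnorm_sq_cvg_le _ _ (fun n => f - (b^-1)%:C *: S n) _
  (fun n => hnorm f ^+ 2 - b^-1 * s n)) => [| |n].
- apply: cvgB; first exact: cvg_cst.
  by apply: cvgZl_tmp; exact: frame_op_cvg.
- by apply: cvgB; [exact: cvg_cst|apply: cvgMl_tmp].
have dS : dotp f (S n) = (s n)%:C.
  rewrite linear_sumr rmorph_sum/=; apply: eq_bigr => k _.
  by rewrite linearZr_LR/= rmorphXn/= modulusE normCKC.
have -> : hnorm (f - (b^-1)%:C *: S n) ^+ 2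
    = hnorm f ^+ 2 + b^-1 ^+ 2 * hnorm (S n) ^+ 2 - 2 * (b^-1 * s n).
  apply: complexI.
  rewrite -dotp_hnorm dnormB dnormZ linearZr_LR/= !dotp_hnorm dS.
  (* The cross term is real, hence equal to its conjugate, which produces the factor 2. *)
  have sr : (s n)%:C \is Num.real by rewrite complex_real.
  have br : (b^-1)%:C \is Num.real by rewrite complex_real.
  rewrite (conj_Creal br) (conj_Creal (realM br sr)) real_normK//.
  by rewrite !rmorphD rmorphN !rmorphM/=; ring.
have := synthesis_bound (coef f) 0 n; rewrite -/(s n) => Sb.
have : b^-1 ^+ 2 * hnorm (S n) ^+ 2 <= b^-1 * s n.
  rewrite expr2 -mulrA ler_wpM2l ?invr_ge0 ?(ltW b0)//.
  by rewrite ler_pdivrMl.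
lra.
Qed.

(** Solving [u - err u = f] gives f = S u / b, so the frame coefficients of [u] divided by [b]
    expand [f]. That [K] is fixed before [f] is what later yields continuity of evaluations. *)
Lemma frame_expansion : exists K : R, forall f, exists c : nat -> R[i],
  [/\ cvgn (series (fun n => modulus (c n) ^+ 2)),
     forall n, series (fun n => modulus (c n) ^+ 2) n <= K * hnorm f ^+ 2 &
     series (fun n => c n *: phi n) @ \oo --> f].
Proof.
have b0 := frame_ub_gt0.
have [a0 ab _] := phi_frame.
(* [err_bound] contracts squared norms, hence the square root. *)
pose q := Num.sqrt (1 - a / b).
have q1 : q < 1.
  by rewrite -sqrtr1 ltr_sqrt// ltrBlDr ltrDl divr_gt0.
have r0 : 0 <= 1 - a / b by rewrite subr_ge0 ler_pdivrMr// mul1r.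
have qerr f : hnorm (err f) <= q * hnorm f.
  rewrite -(ler_pXn2r (n := 2))// ?nnegrE ?mulr_ge0 ?sqrtr_ge0 ?hnorm_ge0//.
  by rewrite exprMn sqr_sqrtr// err_bound.
pose E : {linear H -> H} :=
  HB.pack err (GRing.isLinear.Build _ _ _ _ err err_linear).
(* The coefficients of [u] have square sum at most b ||u||^2, division by [b] contributes b^-2, and
   ||u|| <= ||f|| / (1 - q). *)
exists (b^-1 * (1 - q)^-1 ^+ 2) => f.
have [u uf] := @contraction_resolvent _ _ E q (sqrtr_ge0 _) q1 qerr f.
have fE : f = (b^-1)%:C *: frame_op u by rewrite -uf /=/err subKr.
have uq : hnorm u <= (1 - q)^-1 * hnorm f.
  rewrite ler_pdivlMl ?subr_gt0// mulrBl mul1r lerBlDr.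
  rewrite -{1}(subrK (E u) u) uf (le_trans (ler_hnormD _ _))// lerD2l.
  exact: qerr.
have [cu _ ub] := frame_coef u.
exists (fun n => (b^-1)%:C * coef u n).
have -> : (fun n => modulus ((b^-1)%:C * coef u n) ^+ 2) =
    b^-1 ^+ 2 *: (fun n => modulus (coef u n) ^+ 2).
  apply/funext => n /=; rewrite modulusM exprMn; congr (_ * _); congr (_ ^+ 2).
  by apply: complexI; rewrite modulusE ger0_norm// ler0c invr_ge0 ltW.
split; first exact: is_cvg_seriesZ.
  move=> n; rewrite seriesZ/=.
  have h1 : series (fun n => modulus (coef u n) ^+ 2) n <= b * hnorm u ^+ 2.
    apply: le_trans ub.
    exact: (ler_series_lim n (fun k => sq_modulus_ge0 _)).
  have h2 : hnorm u ^+ 2 <= (1 - q)^-1 ^+ 2 * hnorm f ^+ 2.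
    rewrite -exprMn lerXn2r ?nnegrE ?mulr_ge0 ?invr_ge0 ?hnorm_ge0//.
    by rewrite subr_ge0 ltW.
  apply: (@le_trans _ _ (b^-1 ^+ 2 * (b * hnorm u ^+ 2))).
    by rewrite ler_wpM2l// sqr_ge0.
  by rewrite mulrA expr2 mulfVK ?gt_eqF// -mulrA ler_wpM2l// invr_ge0 ltW.
(* The scalar multiple is treated as a linear combination with the zero series. *)
rewrite fE (_ : (fun n => _) = fun n => ((b^-1)%:C * coef u n + 0) *: phi n).
  rewrite -[X in _ --> X]addr0.
  apply: cvg_series_lincomb; first exact: frame_op_cvg.
  rewrite (_ : series _ = fun=> 0); first exact: cvg_cst.
  by apply/funext => n; rewrite /series/= big1// => i _; rewrite scale0r.
by apply/funext => n; rewrite addr0.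
Qed.

End Frame.

(** * Square-summable sequences and their pairing *)

Section Pairing.
Variable R : realType.

Lemma in_l2P (c : nat -> R[i]) :
  in_l2 c <-> cvgn (series (fun n => modulus (c n) ^+ 2)).
Proof.
split=> [|cc]; first by apply: cvg_series_EFin => n; exact: sq_modulus_ge0.
by rewrite /in_l2 nneseries_EFin// ltry.
Qed.

Lemma in_l2_lincomb (k : R[i]) (c d : nat -> R[i]) :
  in_l2 c -> in_l2 d -> in_l2 (fun n => k * c n + d n).
Proof.
move=> /in_l2P cc /in_l2P dd; apply/in_l2P.
(* This majorant comes from (x + y)^2 <= 2 x^2 + 2 y^2. *)
pose w n := 2 * modulus k ^+ 2 * modulus (c n) ^+ 2 + 2 * modulus (d n) ^+ 2.
have cw : cvgn (series w).
  apply: is_cvg_seriesD.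
    by apply: (@is_cvg_seriesZ _ (fun n => modulus (c n) ^+ 2)).
  by apply: (@is_cvg_seriesZ _ (fun n => modulus (d n) ^+ 2)).
have le_w n : modulus (k * c n + d n) ^+ 2 <= w n.
  have := @ler_hnormD _ (Cplx R) (k * c n) (d n).
  rewrite -!modulus_hnorm modulusM => h.
  apply: (@le_trans _ _ ((modulus k * modulus (c n) + modulus (d n)) ^+ 2)).
    by rewrite lerXn2r ?nnegrE ?addr_ge0 ?mulr_ge0 ?modulus_ge0.
  have := sqr_ge0 (modulus k * modulus (c n) - modulus (d n)).
  by rewrite /w; nra.
apply: series_le_cvg cw => n //; first exact: sq_modulus_ge0.
exact: le_trans (sq_modulus_ge0 _) (le_w n).
Qed.

Lemma pairing_cvg (c d : nat -> R[i]) : in_l2 c -> in_l2 d ->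
  cvgn (series (fun n => c n *: d n : Cplx R)).
Proof.
move=> /in_l2P cc /in_l2P dd; apply: cplx_abs_cvg_series.
apply: series_le_cvg (is_cvg_seriesD cc dd) => n /=.
- exact: modulus_ge0.
- by rewrite addr_ge0// sqr_ge0.
rewrite modulusM -[leRHS]/(modulus (c n) ^+ 2 + modulus (d n) ^+ 2).
have := modulus_ge0 (c n); have := modulus_ge0 (d n).
have := sqr_ge0 (modulus (c n) - modulus (d n)).
nra.
Qed.

(** Termwise AM-GM. A bound by the mean of [A] and [B] is enough, since it is only applied with
    ||f|| < 1 to bound a linear map. *)
Lemma pairing_bound (c d : nat -> R[i]) (x : Cplx R) (A B : R) :
  series (fun n => c n *: d n : Cplx R) @ \oo --> x ->
  (forall n, series (fun n => modulus (c n) ^+ 2) n <= A) ->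
  (forall n, series (fun n => modulus (d n) ^+ 2) n <= B) ->
  hnorm x <= (A + B) / 2.
Proof.
move=> /cvg_hnorm xP cA dB.
apply: (cvgr_to_le xP); apply: nearW => n.
apply: le_trans (ler_hnorm_sum _ _) _.
pose w i := modulus (c i) ^+ 2 + modulus (d i) ^+ 2.
apply: (@le_trans _ _ (\sum_(0 <= i < n) w i / 2)).
  apply: ler_sum => k _; rewrite hnormZ -modulus_hnorm.
  by have := sqr_ge0 (modulus (c k) - modulus (d k)); rewrite /w; nra.
rewrite -mulr_suml big_split/= ler_pM2r ?invr_gt0//.
exact: lerD (cA n) (dB n).
Qed.

End Pairing.

Local Close Scope complex_scope.

(** * Construction and properties of the evaluation map *)

Theorem theorem3p8 (R : realType) (H : completeNormedModType R[i])
    (dotp : {dot H for (@Num.conj R[i])})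
    (hilbertH : hilbert_norm dotp)
    (phi : nat -> H) (a b : R)
    (phi_frame : frame dotp phi a b)
    (Omega : Type) (g : nat -> Omega -> Cplx R)
    (phi_functions : vectors_are_functions phi g)
    (g_l2 : forall t : Omega, in_l2 (fun n => g n t)) :
  exists ev : H -> (Omega -> Cplx R),
    rkhs ev /\ (forall n : nat, ev (phi n) = g n).
Proof.
(* The chosen [c f] need not depend linearly on [f]; [evE] below removes the dependence on the
   choice. *)
have [K /choice[c cP]] := frame_expansion hilbertH phi_frame.
have c_l2 f : in_l2 (c f) by apply/in_l2P; have [] := cP f.
have c_cvg f : series (fun n => c f n *: phi n) @ \oo --> f by have [] := cP f.
pose ev f t : Cplx R := limn (series (fun n => c f n *: g n t)).
have ev_cvg f t : series (fun n => c f n *: g n t) @ \oo --> ev f t.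
  exact: pairing_cvg (c_l2 f) (g_l2 t).
(* Two expansions of [f] differ by a sequence whose synthesis in [H] is 0, so the forward direction
   of [phi_functions] makes the two values at [t] agree. *)
have evE d f : in_l2 d -> series (fun n => d n *: phi n) @ \oo --> f ->
    forall t, series (fun n => d n *: g n t) @ \oo --> ev f t.
  move=> d_l2 df t.
  have dc_l2 := in_l2_lincomb (-1) (c_l2 f) d_l2.
  have /(_ t) : forall t,
      series (fun n => (-1 * c f n + d n) *: g n t) @ \oo --> (0 : Cplx R).
    apply/(phi_functions _ dc_l2).
    by rewrite -(subrr f); exact: cvg_series_diff (c_cvg f) df.
  move=> /(cvg_series_lincomb 1)/(_ (ev_cvg f t)).
  rewrite scaler0 add0r; apply: cvg_trans.
  apply: near_eq_cvg; apply: nearW => n.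
  by apply: eq_bigr => k _; congr (_ *: _); ring.
have ev_linear : linear ev.
  move=> k f h; apply/funext => t.
  have evkfh := evE _ _ (in_l2_lincomb k (c_l2 f) (c_l2 h))
    (cvg_series_lincomb k (c_cvg f) (c_cvg h)) t.
  exact: cvg_unique _ evkfh (cvg_series_lincomb k (ev_cvg f t) (ev_cvg h t)).
exists ev; split; last first.
  move=> n; apply/funext => t; symmetry.
  (* The Kronecker sequence is another expansion of [phi n], and its pointwise synthesis is
     [g n t]. *)
  pose d m : R[i] := (m == n)%:R.
  have dE (W : lmodType R[i]) (v : nat -> W) :
    (fun m => d m *: v m) = (fun m => if m == n then v n else 0).
    apply/funext => m; rewrite /d; case: eqP => [->|_]; first exact: scale1r.
    exact: scale0r.
  have d_l2 : in_l2 d.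
    apply/in_l2P; apply/cvg_ex; exists 1.
    rewrite (_ : (fun m => _) = (fun m => if m == n then 1 else 0)).
      exact: (@cvg_series_single _ R^o).
    apply/funext => m; rewrite /d; case: eqP => _; rewrite /modulus.
      by rewrite normr1/= expr1n.
    by rewrite normr0/= expr0n.
  have := evE d (phi n) d_l2; rewrite dE => /(_ (@cvg_series_single _ _ _ _) t).
  rewrite dE; apply: (cvg_unique (@norm_hausdorff _ _)).
  exact: cvg_series_single.
split; first split => //.
  (* Equal values make the difference of the expansions vanish pointwise; the backward direction of
     [phi_functions] then makes it vanish in [H]. *)
  move=> f h fh.
  have fhc := in_l2_lincomb (-1) (c_l2 f) (c_l2 h).
  have : series (fun n => (-1 * c f n + c h n) *: phi n) @ \oo --> (0 : H).
    apply/(phi_functions _ fhc) => t.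
    rewrite -(subrr (ev f t)) {1}fh.
    exact: cvg_series_diff (ev_cvg f t) (ev_cvg h t).
  have := cvg_series_diff (c_cvg f) (c_cvg h).
  move=> /(cvg_unique (@norm_hausdorff _ _)) uniq /uniq.
  by move=> /eqP; rewrite subr_eq0 => /eqP.
move=> t.
pose evt f : Cplx R := ev f t.
have evt_linear : linear evt by move=> k f h; rewrite /evt ev_linear.
pose E : {linear H -> Cplx R} :=
  HB.pack evt (GRing.isLinear.Build _ _ _ _ evt evt_linear).
apply: (@bounded_linear_continuous _ _ _ E).
pose B := limn (series (fun n => modulus (g n t) ^+ 2)).
(* Boundedness on the open unit ball suffices for a linear map. The absolute value appears because
   the sign of [K] is not recorded. *)
apply/ex_bound; exists ((`|K| + B) / 2)%:C%C.
apply/nbhs_norm0P; exists 1 => //= f f1.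
have [_ cK _] := cP f.
rewrite /= -(hnormE (evt f)) lecR.
apply: pairing_bound (ev_cvg f t) _ _ => n.
  apply: le_trans (cK n) _; apply: le_trans (ler_norm _) _.
  rewrite normrM ler_piMr//.
  rewrite ger0_norm ?sqr_ge0// expr_le1 ?hnorm_ge0//.
  by rewrite -lecR hnormE ltW.
apply: ler_series_lim => [k|]; first exact: sq_modulus_ge0.
by apply/in_l2P.
Qed.
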